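(* Let $\mathscr{F}=\{[0),[1)\}$. For every non-injective monoid endomorphism $\mathfrak{e}$ of the monoid $\boldsymbol{B}_{\omega}^{\mathscr{F}}$ exactly one of the following conditions holds: (1) $\mathfrak{e}$ is the annihilating endomorphism, i.e., $\mathfrak{e}=\gamma_0=\delta_0$; (2) $\mathfrak{e}=\gamma_k$ for some positive integer $k$; (3) $\mathfrak{e}=\delta_k$ for some positive integer $k$.
   Context: $\omega$ is the set of non-negative integers; for $a\in\omega$, $[a)=\{x\in\omega: x\geqslant a\}$; for $n\in\mathbb{Z}$ and $F\subseteq\omega$, $n+F=\{n+k: k\in F\}$. For $\mathscr{F}=\{[0),[1)\}$, $\boldsymbol{B}_{\omega}^{\mathscr{F}}$ is the set $\omega\times\omega\times\mathscr{F}$ with the operation $$(i_1,j_1,F_1)\cdot(i_2,j_2,F_2)=\begin{cases}(i_1-j_1+i_2,\,j_2,\,(j_1-i_2+F_1)\cap F_2), & j_1\leqslant i_2;\\ (i_1,\,j_1-i_2+j_2,\,F_1\cap(i_2-j_1+F_2)), & j_1\geqslant i_2.\end{cases}$$ This is an (inverse) monoid with identity $(0,0,[0))$. A monoid endomorphism is a semigroup endomorphism fixing the identity. The annihilating monoid endomorphism is the constant map sending every element to $(0,0,[0))$. Maps are written on the right of their arguments. For $k\in\omega$ the maps $\gamma_k,\delta_k:\boldsymbol{B}_{\omega}^{\mathscr{F}}\to\boldsymbol{B}_{\omega}^{\mathscr{F}}$ are defined, for all $i,j\in\omega$, by $(i,j,[0))\gamma_k=(i,j,[1))\gamma_k=(ki,kj,[0))$,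 and $(i,j,[0))\delta_k=(ki,kj,[0))$, $(i,j,[1))\delta_k=(k(i+1),k(j+1),[0))$. *)

(* Defs.v *)
From HB Require Import structures.
From mathcomp Require Import all_boot all_order all_algebra.
From mathcomp Require Import boolp classical_sets.
From mathcomp Require Import zify.

Set Implicit Arguments.
Unset Strict Implicit.
Unset Printing Implicit Defensive.

Local Open Scope classical_set_scope.
Local Open Scope nat_scope.

(* [a) in the usual notation, omega being nat. *)
Definition up (a : nat) : set nat := [set x | a <= x].

(* The trace on omega of the translate n + F = {n + k : k in F}.  For n < 0
   the translate may contain negative integers, but it only ever occurs
   intersected with a subset of omega. *)
Definition shift (n : int) (F : set nat) : set nat :=
  Posz @^-1` [set (n + k%:Z)%R | k in F].

(* Coerced to the type of its members when used as a type. *)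
Definition Fam : set (set nat) := [set F | F = up 0 \/ F = up 1].

(* The product formula for arbitrary subsets of omega.  The natural number
   i1 + i2 - j1 (resp. j1 + j2 - i2) is the integer i1 - j1 + i2
   (resp. j1 - i2 + j2): the subtraction never truncates in its branch.  At
   j1 = i2 the two cases agree, see [prod_raw_ge]. *)
Definition prod_raw (x y : nat * nat * set nat) : nat * nat * set nat :=
  let: (i1, j1, F1) := x in
  let: (i2, j2, F2) := y in
  if j1 <= i2 then (i1 + i2 - j1, j2, shift (j1%:Z - i2%:Z)%R F1 `&` F2)
  else (i1, j1 + j2 - i2, F1 `&` shift (i2%:Z - j1%:Z)%R F2).

Lemma shift_up (m n a : nat) : shift (m%:Z - n%:Z)%R (up a) `&` [set: nat] =
  up (m + a - n).
Proof.
apply/seteqP; split=> x /=; rewrite /shift /up /=.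
  by case=> -[k /= ak xk] _; lia.
by move=> h; split=> //; exists (x + n - m); lia.
Qed.

Lemma up_setI a b : up a `&` up b = up (maxn a b).
Proof.
by apply/seteqP; split=> x /=; rewrite /up /= geq_max => /andP.
Qed.

Lemma prod_rawE i1 j1 a1 i2 j2 a2 :
  prod_raw (i1, j1, up a1) (i2, j2, up a2) =
  if j1 <= i2 then (i1 + i2 - j1, j2, up (maxn (j1 + a1 - i2) a2))
  else (i1, j1 + j2 - i2, up (maxn a1 (i2 + a2 - j1))).
Proof.
by rewrite /prod_raw -(setIT (shift (i2%:Z - _)%R _))
  -(setIT (shift (j1%:Z - _)%R _)) !shift_up !up_setI.
Qed.

Lemma prod_raw_ge i1 j1 F1 i2 j2 F2 : i2 <= j1 ->
  prod_raw (i1, j1, F1) (i2, j2, F2) =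
  (i1, j1 + j2 - i2, F1 `&` shift (i2%:Z - j1%:Z)%R F2).
Proof.
move=> le21; rewrite /prod_raw; case: leqP => // le12.
have -> : j1 = i2 by apply/eqP; rewrite eqn_leq le12.
have shift0 F : shift (i2%:Z - i2%:Z)%R F = F.
  apply/seteqP; split=> x; rewrite /shift /=.
    by case=> k Fk xk; have -> : x = k by lia.
  by move=> Fx; exists x => //; lia.
by rewrite !shift0 addnK addKn.
Qed.

Lemma FamP (F : set nat) : F \in Fam -> exists2 a, a <= 1 & F = up a.
Proof. by rewrite inE => -[] ->; [exists 0 | exists 1]. Qed.

Lemma up_Fam a : a <= 1 -> up a \in Fam.
Proof. by rewrite inE; case: a => [|[|//]] _; [left | right]. Qed.

Lemma prod_raw_Fam x y :
  x.2 \in Fam -> y.2 \in Fam -> (prod_raw x y).2 \in Fam.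
Proof.
case: x y => [[i1 j1] F1] [[i2 j2] F2] /= /FamP[a a1 ->] /FamP[b b1 ->].
by rewrite -/(prod_raw (i1, j1, up a) (i2, j2, up b)) prod_rawE;
  case: ifP => h /=; apply: up_Fam; lia.
Qed.

Definition BF : Type := (nat * nat * Fam)%type.

HB.instance Definition _ := Choice.copy BF (nat * nat * Fam)%type.

Definition raw (x : BF) : nat * nat * set nat := (x.1, val x.2).

Definition prodBF (x y : BF) : BF :=
  ((prod_raw (raw x) (raw y)).1,
   Sub (prod_raw (raw x) (raw y)).2 (@prod_raw_Fam (raw x) (raw y) (valP x.2) (valP y.2))).

Definition up0 : Fam := Sub (up 0) (@up_Fam 0 isT).
Definition up1 : Fam := Sub (up 1) (@up_Fam 1 isT).

Definition oneBF : BF := (0, 0, up0).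

Lemma raw_inj : injective raw.
Proof. by case=> [p F] [q G] [-> /val_inj ->]. Qed.

Lemma raw_prod x y : raw (prodBF x y) = prod_raw (raw x) (raw y).
Proof. by rewrite /raw /= -surjective_pairing. Qed.

Lemma rawP (x : BF) : exists i j a, raw x = (i, j, up a).
Proof.
case: x => [[i j] F]; have [a _ Fa] := FamP (valP F).
by exists i, j, a; rewrite /raw /= -Fa.
Qed.

Lemma raw_one : raw oneBF = (0, 0, up 0).
Proof. by []. Qed.

Lemma prodBFA : associative prodBF.
Proof.
move=> x y z; apply: raw_inj; rewrite !raw_prod.
have [i1 [j1 [a1 ->]]] := rawP x; have [i2 [j2 [a2 ->]]] := rawP y.
have [i3 [j3 [a3 ->]]] := rawP z.
rewrite !prod_rawE; case: (leqP j2 i3) => h1; case: (leqP j1 i2) => h2;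
  rewrite !prod_rawE; do ?case: leqP => ?; congr (_, _, up _); lia.
Qed.

Lemma prod1BF : left_id oneBF prodBF.
Proof.
move=> x; apply: raw_inj; rewrite !raw_prod; have [i [j [a ->]]] := rawP x.
by rewrite raw_one prod_rawE /=; congr (_, _, up _); lia.
Qed.

Lemma prodBF1 : right_id oneBF prodBF.
Proof.
move=> x; apply: raw_inj; rewrite !raw_prod; have [i [j [a ->]]] := rawP x.
by rewrite raw_one prod_rawE /=; case: leqP => ?; congr (_, _, up _); lia.
Qed.

HB.instance Definition _ := isMonoid.Build BF prodBFA prod1BF prodBF1.

Definition annihilating (x : BF) : BF := oneBF.

Definition gamma (k : nat) (x : BF) : BF :=
  let: (i, j, _) := x in (k * i, k * j, up0).

Definition delta (k : nat) (x : BF) : BF :=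
  let: (i, j, F) := x in
  if F == up0 then (k * i, k * j, up0) else (k * i.+1, k * j.+1, up0).

Lemma Fam_cases (F : Fam) : F = up0 \/ F = up1.
Proof. by have := valP F; rewrite inE => -[] h; [left|right]; apply: val_inj. Qed.

Lemma up1_neq0 : up1 != up0.
Proof.
apply/eqP => /(congr1 val) /= h.
by have : up 0 0 by []; rewrite -h.
Qed.

Lemma delta_up0 k i j : delta k (i, j, up0) = (k * i, k * j, up0).
Proof. by rewrite /delta eqxx. Qed.

Lemma delta_up1 k i j : delta k (i, j, up1) = (k * i.+1, k * j.+1, up0).
Proof. by rewrite /delta (negbTE up1_neq0). Qed.

Definition exactly_one (P Q R : Prop) : Prop :=
  [\/ [/\ P, ~ Q & ~ R], [/\ ~ P, Q & ~ R] | [/\ ~ P, ~ Q & R]].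

(* Main.v *)
Require Import Defs.
From mathcomp Require Import all_boot.
From mathcomp Require Import boolp classical_sets zify.

(** [code], with [i.*2 + a, j.*2 + a] for the image of [(i, j, [a))], embeds the
    monoid in the bicyclic monoid, as the pairs of entries of equal parity.
    Every element is [v^i f^a u^j], where [v], [f], [u] have codes [(2, 0)],
    [(1, 1)], [(0, 2)].  Since [u v = 1], an endomorphism sends [u] and [v] to
    elements with codes [(0, 2 k)] and [(2 k, 0)]; it sends [f] to an idempotent
    with code [(s, s)], where [s <= 2 k] because [f v = v].  If [0 < s < 2 k] it
    is injective, [s = 0] gives [gamma k], and [s = 2 k] gives [delta k]. *)

Definition code (x : BF) : nat * nat :=
  let: (i, j, F) := x in (i.*2 + (F != up0), j.*2 + (F != up0)).

(** The usual bicyclic product without its case split: at least one of the two truncated differences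
    is zero. *)
Definition bicyclic_mul (p q : nat * nat) : nat * nat :=
  (p.1 + (q.1 - p.2), q.2 + (p.2 - q.1)).

(** The parity of an entry recovers [F], and its half recovers [i] or [j]. *)
Lemma code_inj : injective code.
Proof.
move=> [[i j] F] [[i' j'] F'].
by case: (Fam_cases F) (Fam_cases F') => -> [] ->;
  rewrite /code ?eqxx ?up1_neq0 => -[hi hj]; try lia;
  do 2 f_equal; lia.
Qed.

Lemma code_raw (x : BF) i j a :
  a <= 1 -> raw x = (i, j, up a) -> code x = (i.*2 + a, j.*2 + a).
Proof.
case: x => [[i' j'] F] a1 [-> -> hF].
have -> : F = if a == 0 then up0 else up1.
  by apply: val_inj; case: a a1 hF => [|[]].
by case: a a1 {hF} => [|[]] // _; rewrite /code ?eqxx ?up1_neq0.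
Qed.

Lemma raw_code (x : BF) : exists i j a,
  [/\ a <= 1, raw x = (i, j, up a) & code x = (i.*2 + a, j.*2 + a)].
Proof.
case: x => [[i j] F]; case: (Fam_cases F) => ->; exists i, j.
  by exists 0; split=> //; apply: code_raw.
by exists 1; split=> //; apply: code_raw.
Qed.

(** As [a1, a2 <= 1], comparing [j1.*2 + a1] with [i2.*2 + a2] refines comparing [j1] with [i2]; at
    [j1 = i2] the larger of [a1] and [a2] survives, as in the intersection of the two sets. *)
Lemma code_mul (x y : BF) :
  code (x * y)%g = bicyclic_mul (code x) (code y).
Proof.
have [i1 [j1 [a1 [le1 rx ->]]]] := raw_code x.
have [i2 [j2 [a2 [le2 ry ->]]]] := raw_code y.
have := raw_prod x y; rewrite rx ry prod_rawE.
rewrite /bicyclic_mul; case: leqP => h /code_raw -> /=; try lia;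
  congr (_, _); lia.
Qed.

Lemma code1 : code 1%g = (0, 0).
Proof. by rewrite -[1%g]/oneBF /oneBF /code eqxx. Qed.

Lemma code_expl (x : BF) m n : code x = (m, 0) -> code (x ^+ n)%g = (m * n, 0).
Proof.
move=> cx; elim: n => [|n IHn]; first by rewrite expg0 code1 muln0.
by rewrite expgS code_mul cx IHn /bicyclic_mul /=; congr (_, _); lia.
Qed.

Lemma code_expr (x : BF) m n : code x = (0, m) -> code (x ^+ n)%g = (0, m * n).
Proof.
move=> cx; elim: n => [|n IHn]; first by rewrite expg0 code1 muln0.
by rewrite expgS code_mul cx IHn /bicyclic_mul /=; congr (_, _); lia.
Qed.

Lemma code_parity (x : BF) : odd (code x).1 = odd (code x).2.
Proof. by case: x => [[i j] F] /=; lia. Qed.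

Lemma bicyclic_mul_eq1 p q :
  bicyclic_mul p q = (0, 0) -> exists2 m, p = (0, m) & q = (m, 0).
Proof.
by case: p q => [m n] [p q] [] /= h1 h2; exists n; congr (_, _); lia.
Qed.

(** On codes this is [(2i, 0) (a, a) (0, 2j) = (2i + a, 2j + a)]. *)
Lemma BF_decomp i j (F : Fam) :
  (i, j, F) = (((1, 0, up0)%N : BF) ^+ i * (((0, 0, F)%N : BF) * ((0, 1, up0)%N : BF) ^+ j))%g.
Proof.
apply: code_inj; rewrite !code_mul (code_expl _ 2) ?(code_expr _ 2);
  try by rewrite /code eqxx.
by rewrite /bicyclic_mul /code /=; congr (_, _); lia.
Qed.

Lemma code_endo (e : UMagmaMorphism.type BF BF) :
  exists k s, s <= k.*2 /\ forall i j (F : Fam),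
    code (e (i, j, F)) =
    (k.*2 * i + s * (F != up0), k.*2 * j + s * (F != up0)).
Proof.
pose v : BF := (1, 0, up0); pose u : BF := (0, 1, up0).
pose f : BF := (0, 0, up1).
have cv : code v = (2, 0) by rewrite /v /code eqxx.
have cu : code u = (0, 2) by rewrite /u /code eqxx.
have cf : code f = (1, 1) by rewrite /f /code up1_neq0.
have uv : (u * v = 1)%g by apply: code_inj; rewrite code_mul cu cv code1.
have ff : (f * f = f)%g by apply: code_inj; rewrite code_mul cf.
have fv : (f * v = v)%g by apply: code_inj; rewrite code_mul cf cv.
have euv := congr1 code (congr1 e uv).
rewrite gmulfM gmulf1 code_mul code1 in euv.
have [m ceu cev] := bicyclic_mul_eq1 _ _ euv.
(* The entries of the code [(m, 0)] have equal parity. *)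
have [k mk] : exists k, m = k.*2.
  by exists m./2; have := code_parity (e v); rewrite cev /=; lia.
rewrite mk in ceu cev.
(* Idempotency of [(p, q)] makes both [p - q] and [q - p] vanish. *)
have [s cef] : exists s, code (e f) = (s, s).
  have := congr1 code (congr1 e ff); rewrite gmulfM code_mul.
  case: (code (e f)) => p q [] /= h1 h2.
  by exists p; congr (_, _); lia.
exists k, s; split.
  have := congr1 code (congr1 e fv); rewrite gmulfM code_mul cef cev.
  by case=> /=; lia.
move=> i j F.
have -> : code (e (i, j, F)) = bicyclic_mul (k.*2 * i, 0)
    (bicyclic_mul (s * (F != up0), s * (F != up0)) (0, k.*2 * j)).
  rewrite BF_decomp !gmulfM !gmulfXn !code_mul.
  rewrite (code_expl _ _ _ cev) (code_expr _ _ _ ceu).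
  case: (Fam_cases F) => ->; last by rewrite cef up1_neq0 muln1.
  have -> : e (0%N, 0%N, up0) = 1%g by apply: gmulf1.
  by rewrite code1 eqxx muln0.
by rewrite /bicyclic_mul /=; congr (_, _); lia.
Qed.

Lemma gamma0 : annihilating =1 gamma 0.
Proof. by move=> [[i j] F]. Qed.

Lemma gamma0_delta0 : gamma 0 =1 delta 0.
Proof. by move=> [[i j] F]; rewrite /delta; case: ifP. Qed.

Lemma gamma_inj k l : gamma k =1 gamma l -> k = l.
Proof. by move=> /(_ (1, 0, up0)) [] ; rewrite !muln1. Qed.

(** The idempotent [(0, 0, up1)] separates the two families: [gamma k] sends it to the identity,
    [delta l] to [(l, l, up0)]. *)
Lemma gamma_delta k l : gamma k =1 delta l -> l = 0.
Proof.
move=> /(_ (0, 0, up1)); rewrite delta_up1 /gamma => -[].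
by rewrite muln0 muln1.
Qed.

Theorem theorem1 (e : UMagmaMorphism.type BF BF) (he : ~ injective e) :
  (annihilating =1 gamma 0 /\ gamma 0 =1 delta 0) /\
  exactly_one
    (e =1 annihilating)
    (exists2 k : nat, 0 < k & e =1 gamma k)
    (exists2 k : nat, 0 < k & e =1 delta k).
Proof.
split; first by split; [exact: gamma0 | exact: gamma0_delta0].
have not_gamma_delta k l : 0 < l -> e =1 gamma k -> e =1 delta l -> False.
  move=> l0 eg ed.
  by have := gamma_delta k l (ftrans (fsym eg) ed); lia.
have [k [s [sk ce]]] := code_endo e.
have [s0 | s0] := posnP s.
  have eg : e =1 gamma k.
    move=> [[i j] F]; apply: code_inj; rewrite ce s0 /gamma /code eqxx /=.
    by congr (_, _); lia.
  have nd : ~ (exists2 l, 0 < l & e =1 delta l).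
    by case=> l l0; apply: (not_gamma_delta _ _ l0 eg).
  (* With [s = 0], the value [k = 0] is the annihilating case. *)
  have [k0 | k0] := posnP k.
    apply: Or31; split=> //; first by move=> x; rewrite eg k0 gamma0.
    case=> l l0 el.
    by have := gamma_inj _ _ (ftrans (fsym eg) el); lia.
  apply: Or32; split=> //; last by exists k.
  by move=> ea; have := gamma_inj _ _ (ftrans (fsym eg) (ftrans ea gamma0)); lia.
have [sk2 | sk2] := eqVneq s k.*2.
  have k0 : 0 < k by lia.
  have ed : e =1 delta k.
    move=> [[i j] F]; apply: code_inj; rewrite ce sk2.
    case: (Fam_cases F) => ->; rewrite ?delta_up0 ?delta_up1 /code
      ?eqxx ?up1_neq0 /=; congr (_, _); lia.
  apply: Or33; split; last by exists k.
    move=> ea; apply: (not_gamma_delta 0 k) => // x.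
    by rewrite ea gamma0.
  by case=> l _ eg; apply: not_gamma_delta eg ed.
(* There remains [0 < s < k.*2], where [e] is shown to be injective. *)
case: he => -[[i j] F] [[i' j'] F'] /(congr1 code); rewrite !ce => -[].
(* Since [s < k.*2], the term [s * a] never reaches the next multiple of [k.*2], so entries are
   ordered first by [n]; then [0 < s] separates the values of [a]. *)
have entry_lt (a a' : bool) n n' :
    n < n' -> k.*2 * n + s * a < k.*2 * n' + s * a'.
  move=> lt_nn'; have := leq_mul (leqnn k.*2) lt_nn'; rewrite mulnS.
  by case: a; case: a'; lia.
have entry_inj (a a' : bool) n n' :
    k.*2 * n + s * a = k.*2 * n' + s * a' -> n = n' /\ a = a'.
  have [/(entry_lt a a')|/(entry_lt a' a)|->] := ltngtP n n'; try lia.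
move=> /entry_inj[-> hF] /entry_inj[-> _]; congr (_, _, _).
by case: (Fam_cases F) (Fam_cases F') hF => -> [] ->; rewrite ?eqxx ?up1_neq0.
Qed.
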